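(* Let $\{(P_n,Q_n)\}_{n\in\mathbb N}$ be the numerical solution of the splitting method described in the context, with time-step $\tau\in(0,1)$. There exists a constant $C>0$ such that for $T>0$, $$\sup_{t_n\in[0,T]}\mathbb E\Big[\exp\Big\{\frac{C_e\big(|P_n|^2+|Q_n|^4\big)}{e^{\sigma^2t_n}}\Big\}\Big]\le e^{C(T+1)+H(P_0,Q_0)},$$ where $C_e>0$ is the constant fixed in the context.
   Context: Equation: the stochastic Langevin equation in $\mathbb R^2$, $dP(t)=-\upsilon P(t)\,dt-\nabla U(Q(t))\,dt+\sigma\,dW_t$, $dQ(t)=P(t)\,dt$, with $U(q)=\frac14q^4$ (so $\nabla U(q)=q^3$), constants $\upsilon>0$, $\sigma>0$, deterministic initial value $(P(0),Q(0))\in\mathbb R^2$, and $W$ a one-dimensional standard Wiener process on a filtered complete probability space $(\Omega,\mathcal F,\{\mathcal F_t\}_{t\ge0},\mathbb P)$. Hamiltonian: $H(p,q)=\frac{p^2}{2}+\frac{q^4}{4}+\frac{\upsilon}{2}pq$. The constant $C_e>0$ is a fixed constant for which there is a constant $C'>0$ with $C_e(p^2+q^4)\le H(p,q)+C'\le C'(p^2+q^4+1)$ for all $(p,q)\in\mathbb R^2$ (for instance $C_e=\frac18$ is admissible). Grid: $t_n=n\tau$, $T_n=[t_n,t_{n+1})$, $n\in\mathbb N=\{0,1,2,\dots\}$. Splitting method: $(P_0,Q_0)=(P(0),Q(0))$. Given $(P_n,Q_n)$: (1) Deterministic step: $\bar P_{T_n,t_{n+1}}=P_n+\mathcal A^n_\tau$,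 $\bar Q_{T_n,t_{n+1}}=Q_n+\mathcal B^n_\tau$, where $\mathcal A^n_\tau=\mathcal A_\tau(P_n,Q_n,\bar P_{T_n,t_{n+1}},\bar Q_{T_n,t_{n+1}})$ and $\mathcal B^n_\tau=\mathcal B_\tau(P_n,Q_n,\bar P_{T_n,t_{n+1}},\bar Q_{T_n,t_{n+1}})$ with measurable maps $\mathcal A_\tau,\mathcal B_\tau$. This is a one-step approximation (over time $\tau$) of the Hamiltonian system $d\bar P=-\frac{\upsilon}{2}\bar P\,dt-\bar Q^3\,dt$, $d\bar Q=\bar P\,dt+\frac{\upsilon}{2}\bar Q\,dt$, which is assumed to preserve the Hamiltonian, $H(\bar P_{T_n,t_{n+1}},\bar Q_{T_n,t_{n+1}})=H(P_n,Q_n)$, and to be solvable: there are measurable maps $\psi_\tau,\phi_\tau:\mathbb R^2\to\mathbb R$ with $\bar P_{T_n,t_{n+1}}=\psi_\tau(P_n,Q_n)$, $\bar Q_{T_n,t_{n+1}}=\phi_\tau(P_n,Q_n)$. (2) Stochastic step, solved exactly: $(\tilde P_{T_n,t},\tilde Q_{T_n,t})$ solves on $T_n$ (up to $t_{n+1}$) $d\tilde P=-\frac{\upsilon}{2}\tilde P\,dt+\sigma\,dW_t$, $d\tilde Q=-\frac{\upsilon}{2}\tilde Q\,dt$ with initial value $(\bar P_{T_n,t_{n+1}},\bar Q_{T_n,t_{n+1}})$ at time $t_n$. Then $(P_{n+1},Q_{n+1})=(\tilde P_{T_n,t_{n+1}},\tilde Q_{T_n,t_{n+1}})$. The constant $C$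 may depend on the fixed parameters $\upsilon,\sigma$. *)

(* Defs.v *)
From HB Require Import structures.
From mathcomp Require Import all_boot all_order all_algebra.
From mathcomp Require Import all_classical all_reals all_analysis.

Set Implicit Arguments.
Unset Strict Implicit.
Unset Printing Implicit Defensive.

Import Order.TTheory GRing.Theory Num.Theory.
Import numFieldNormedType.Exports.

Local Open Scope classical_set_scope.
Local Open Scope ring_scope.

Definition hamiltonian (R : realType) (ups p q : R) : R :=
  p ^+ 2 / 2 + q ^+ 4 / 4 + ups / 2 * p * q.

Definition energy_constant (R : realType) (ups Ce : R) : Prop :=
  0 < Ce /\
  exists2 C' : R, 0 < C' & forall p q : R,
    Ce * (p ^+ 2 + q ^+ 4) <= hamiltonian ups p q + C' /\
    hamiltonian ups p q + C' <= C' * (p ^+ 2 + q ^+ 4 + 1).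

(* Time is indexed by R, but only the indices t >= 0 are constrained. *)
Definition is_filtration (R : realType) (d : measure_display)
    (Om : measurableType d) (F : R -> set (set Om)) : Prop :=
  [/\ forall t : R, 0 <= t -> sigma_algebra setT (F t),
      forall t : R, 0 <= t -> F t `<=` measurable &
      forall s t : R, 0 <= s -> s <= t -> F s `<=` F t].

Definition adapted_on (R : realType) (d : measure_display)
    (Om : measurableType d) (F : R -> set (set Om)) (I : set R)
    (X : R -> Om -> R) : Prop :=
  forall t : R, I t -> forall B : set R, measurable B -> F t (X t @^-1` B).

(* The law of an increment is prescribed for s < t only: normal_prob 0 0 is not
   the Dirac mass at 0 but the uniform law on [0, 1]. *)
Record is_wiener (R : realType) (d : measure_display) (Om : measurableType d)
    (P : probability Om R) (F : R -> set (set Om)) (W : R -> Om -> R) : Prop :=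
  IsWiener {
    wiener_adapted : adapted_on F `[0, +oo[ W;
    wiener_start : {ae P, forall w, W 0 w = 0};
    wiener_continuous :
      {ae P, forall w, {within `[0, +oo[, continuous (fun t => W t w)}};
    wiener_normal : forall s t : R, 0 <= s -> s < t ->
      forall B : set R, measurable B ->
      P ((fun w => W t w - W s w) @^-1` B) =
      normal_prob 0 (Num.sqrt (t - s)) B;
    wiener_indep : forall s t : R, 0 <= s -> s < t ->
      forall (A : set Om) (B : set R), F s A -> measurable B ->
      P (A `&` (fun w => W t w - W s w) @^-1` B) =
      (P A * P ((fun w => (W t w - W s w)%R) @^-1` B))%E
  }.

(* X solves dX = a X dt + s dW on [t0, t1] with X(t0) = x0.  As s is constant,
   the Ito integral of s over [t0, t] is s * (W t - W t0). *)
Definition solves_linear_sde (R : realType) (d : measure_display)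
    (Om : measurableType d) (P : probability Om R) (F : R -> set (set Om))
    (W : R -> Om -> R) (a s t0 t1 : R) (x0 : Om -> R) (X : R -> Om -> R) :
    Prop :=
  adapted_on F `[t0, t1] X /\
  {ae P, forall w,
    {within `[t0, t1], continuous (fun t => X t w)} /\
    forall t : R, t0 <= t <= t1 ->
      X t w = x0 w
        + \int[lebesgue_measure]_(r in `[t0, t]) (a * X r w)
        + s * (W t w - W t0 w)}.

Definition grid (R : realType) (tau : R) (n : nat) : R := n%:R * tau.

(* The deterministic step is the (possibly implicit) map (AA, BB), solved by
   (psi, phi); Pb, Qb are its outputs and Pt n, Qt n are the processes of the
   stochastic step on [t_n, t_(n+1)]. *)
Record is_splitting (R : realType) (d : measure_display)
    (Om : measurableType d) (P : probability Om R) (F : R -> set (set Om))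
    (W : R -> Om -> R) (ups sigma tau : R)
    (AA BB : R * R * R * R -> R) (psi phi : R * R -> R) (p0 q0 : R)
    (Pn Qn Pb Qb : nat -> Om -> R) (Pt Qt : nat -> R -> Om -> R) : Prop :=
  IsSplitting {
    split_P0 : forall w, Pn 0%N w = p0;
    split_Q0 : forall w, Qn 0%N w = q0;
    split_detP : forall n w,
      Pb n w = Pn n w + AA (Pn n w, Qn n w, Pb n w, Qb n w);
    split_detQ : forall n w,
      Qb n w = Qn n w + BB (Pn n w, Qn n w, Pb n w, Qb n w);
    split_energy : forall n w,
      hamiltonian ups (Pb n w) (Qb n w) = hamiltonian ups (Pn n w) (Qn n w);
    split_psi : forall n w, Pb n w = psi (Pn n w, Qn n w);
    split_phi : forall n w, Qb n w = phi (Pn n w, Qn n w);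
    split_stoP : forall n, solves_linear_sde P F W (- (ups / 2)) sigma
      (grid tau n) (grid tau n.+1) (Pb n) (Pt n);
    split_stoQ : forall n, solves_linear_sde P F W (- (ups / 2)) 0
      (grid tau n) (grid tau n.+1) (Qb n) (Qt n);
    split_nextP : forall n w, Pn n.+1 w = Pt n (grid tau n.+1) w;
    split_nextQ : forall n w, Qn n.+1 w = Qt n (grid tau n.+1) w
  }.

(* Main.v *)
Require Import Defs.
From HB Require Import structures.
From mathcomp Require Import all_boot all_order all_algebra.
From mathcomp Require Import all_classical all_reals all_analysis.
From mathcomp Require Import measurable_realfun.
From mathcomp Require Import ring lra.

(** The argument runs on the discounted exponential moment
    E[exp(exp(- sigma^2 t) H(P_t, Q_t))], which grows at most like exp(D t) with
    an explicit rate D ([growth_rate]).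

    The deterministic step preserves H, so it does not change this moment at all.
    In the stochastic step, consider first a short time h with damping factor
    r = 1 - ups h / 2 and noise sigma (W_(t+h) - W_t): this maps (p, q) to
    (r p + sigma y, r q) with y centred Gaussian of variance h, independent of the
    past ([independent_integral]). As H is quadratic in p, the conditional
    expectation is a Gaussian integral in closed form
    ([integral_normal_prob_expR_quad]). It multiplies the quadratic part of H by
    1 / (1 - x e^(-x)) at worst, with x = sigma^2 h, and the discount compensates
    with a factor e^(-x): this works because 1 + x <= e^x
    ([variance_factor_le]). The indefinite cross term of H is controlled by its
    quartic term at a cost of order h ([energy_step]). So each short step
    multiplies the moment by at most e^(D h).

    The exact stochastic step is the limit of such short steps: along almost every
    path, the Euler scheme converges to the continuous solution of the linear
    integral equation ([euler_cvg]), since the scheme and the equation see the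
    same Brownian increments and a short Euler step does not enlarge errors. Fatou's lemma
    carries the bound to the limit ([energy_moment_sde]). This also covers the
    noiseless component, and it avoids any computation with the law of the
    stochastic convolution.

    Finally C_e (p^2 + q^4) <= H + C' and the discount is at most 1, so the
    quantity of interest is at most e^(C') times the discounted moment. *)

Set Implicit Arguments.
Unset Strict Implicit.
Unset Printing Implicit Defensive.

Import Order.TTheory GRing.Theory Num.Theory.
Import numFieldNormedType.Exports.

Local Open Scope classical_set_scope.
Local Open Scope ring_scope.

(** * Exponential moments of quadratic functions of a Gaussian *)

Section gaussian_moment.
Context {R : realType}.
Local Notation mu := (@lebesgue_measure R).

(** The density [normal_pdf] represents the Radon-Nikodym derivative only almost
    everywhere, so both derivatives are compared through their integrals. *)
Lemma ge0_integral_normal_prob (m s : R) (f : R -> \bar R) :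
  (forall x, 0 <= f x)%E -> measurable_fun setT f ->
  (\int[normal_prob m s]_x f x =
   \int[mu]_x (f x * (normal_pdf m s x)%:E))%E.
Proof.
move=> f0 mf.
have dom := @normal_prob_dominates R m s.
rewrite -(Radon_Nikodym_SigmaFinite.change_of_variables dom)//=.
apply: ae_eq_integral => //.
- apply: emeasurable_funM => //; apply: (measurable_int mu).
  exact: Radon_Nikodym_SigmaFinite.f_integrable.
- apply: emeasurable_funM => //=; apply/measurableT_comp => //=.
  exact: measurable_normal_pdf.
- apply: ae_eqe_mul2l => /=.
  apply: integral_ae_eq => //=.
  + exact: Radon_Nikodym_SigmaFinite.f_integrable.
  + by apply/measurableT_comp => //; exact: measurable_normal_pdf.
  + by move=> E _ mE; rewrite -Radon_Nikodym_SigmaFinite.f_integral.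
Qed.

(** Completing the square turns the integrand times the Gaussian density into a
    constant multiple of the density with variance [h / (1 - be * h)] and mean
    [al * h / (1 - be * h)]; the constant is the value of the integral. The
    condition [be * h < 1] is what keeps the new variance positive. *)
Lemma integral_normal_prob_expR_quad (al be h : R) : 0 < h -> be * h < 1 ->
  (\int[normal_prob 0 (Num.sqrt h)]_w (expR (al * w + be * w ^+ 2 / 2))%:E =
   (expR (al ^+ 2 * h / (2 * (1 - be * h))) / Num.sqrt (1 - be * h))%:E)%E.
Proof.
move=> h0 bh1.
have d0 : 0 < 1 - be * h by rewrite subr_gt0.
set h' := h / (1 - be * h).
have h'0 : 0 < h' by rewrite divr_gt0.
have sh0 : Num.sqrt h != 0 by rewrite gt_eqF// sqrtr_gt0.
have sh'0 : Num.sqrt h' != 0 by rewrite gt_eqF// sqrtr_gt0.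
pose m := al * h'.
set K := _ / _.
rewrite ge0_integral_normal_prob; last 2 first.
- by move=> x; rewrite lee_fin expR_ge0.
- apply/measurable_EFinP; apply: measurableT_comp => //.
  apply: measurable_funD; first exact: measurable_funM.
  by apply: measurable_funM => //; apply: measurable_funM => //; exact: measurable_funX.
transitivity (\int[mu]_x (K%:E * (normal_pdf m (Num.sqrt h') x)%:E))%E.
  apply: eq_integral => w _; rewrite -!EFinM; congr EFin.
  rewrite !normal_pdfE// /normal_fun /normal_peak !sqr_sqrtr ?ltW//.
  have -> : Num.sqrt (h' * pi *+ 2) = Num.sqrt (h * pi *+ 2) / Num.sqrt (1 - be * h).
    rewrite -sqrtrV ?(ltW d0)// -sqrtrM; last first.
      by rewrite mulrn_wge0// mulr_ge0 ?pi_ge0// ltW.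
    by congr Num.sqrt; rewrite /h' mulrnAl; congr (_ *+ 2); ring.
  rewrite /K invf_div.
  set u := Num.sqrt (1 - _); set v := (Num.sqrt (h * _ *+ 2))^-1.
  have u0 : u != 0 by rewrite gt_eqF// sqrtr_gt0.
  rewrite [LHS]mulrCA -expRD.
  rewrite [RHS](_ : _ = v * (expR (al ^+ 2 * h / (2 * (1 - be * h))) *
    expR (- (w - m) ^+ 2 / (h' *+ 2)))); last by field.
  rewrite -expRD; congr (_ * expR _).
  by rewrite /m /h'; field; rewrite ?gt_eqF//= ?pnatr_eq0.
rewrite ge0_integralZl//.
- by rewrite integral_normal_pdf mule1.
- by apply/measurable_EFinP; exact: measurable_normal_pdf.
- by move=> x _; rewrite lee_fin normal_pdf_ge0.
- by rewrite lee_fin divr_ge0 ?expR_ge0 ?sqrtr_ge0.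
Qed.

End gaussian_moment.

(** * The Hamiltonian under one damped Gaussian step *)

Section hamiltonian_step.
Context {R : realType}.
Implicit Types ups sigma h p q r th : R.

(** Cancellation behind the choice of the discount [exp(- sigma^2 t)]: the
    Gaussian step divides the quadratic part of the energy by [1 - th * x], and
    the discount over the same step wins back exactly [expR x]. Since
    [x expR(-x) <= 1 - expR(-x)] is the inequality [1 + x <= expR x], the latter
    dominates the former with no error term of order [x]. *)
Lemma variance_factor_le (x th : R) : 0 <= x -> th <= expR (- x) ->
  0 < 1 - th * x /\ (1 - th * x)^-1 <= expR x.
Proof.
move=> x0 tx.
have e0 : 0 < expR x by exact: expR_gt0.
have h1 : expR (- x) <= 1 - th * x.
  have : th * x <= expR (- x) * x by rewrite ler_wpM2r.
  have : expR (- x) * (1 + x) <= 1.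
    by rewrite expRN ler_pdivrMl// mulr1 expR_ge1Dx.
  by lra.
have p0 : 0 < 1 - th * x by rewrite (lt_le_trans _ h1)// expR_gt0.
by split=> //; rewrite -[expR x]invrK -expRN lef_pV2 ?posrE ?expR_gt0.
Qed.

(** The exponent produced by one damped Gaussian step, compared with the one
    before it. Write [H = M + S - V] with [M = (p + ups q / 2)^2 / 2],
    [S = q^4 / 4] and [V = ups^2 q^2 / 8]. Only [M] is amplified by the noise,
    and [variance_factor_le] pays for it. The negative part [- V] is discounted
    as well, which costs [(expR x - r^2) V]; the quartic [S] gains at least
    [(expR x - r^2) S], and [V - S] is bounded by [ups^4 / 64], so the total
    loss is of order [h]. *)
Lemma energy_step (ups sigma h r th th' p q : R) :
  0 < ups -> 0 < h -> 0 <= r <= 1 -> 1 - ups * h <= r ^+ 2 ->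
  0 <= th <= 1 ->
  th' = th * expR (- (sigma ^+ 2 * h)) ->
  th' * hamiltonian ups (r * p) (r * q)
    + (th' * r * (p + ups / 2 * q)) ^+ 2 * (sigma ^+ 2 * h)
      / (2 * (1 - th' * (sigma ^+ 2 * h)))
  <= th * hamiltonian ups p q + (sigma ^+ 2 + ups) * ups ^+ 4 / 64 * h.
Proof.
move=> u0 h0 /andP[r0 r1] rh /andP[t0 t1].
set x := sigma ^+ 2 * h => th'E.
have x0 : 0 <= x by rewrite mulr_ge0 ?sqr_ge0// ltW.
have e0 := expR_gt0 (- x).
have th'0 : 0 <= th' by rewrite ?th'E mulr_ge0// ltW.
have th'e : th' <= expR (- x) by rewrite th'E ler_piMl// ltW.
have [d0 dx] := variance_factor_le x0 th'e.
set d := 1 - _ in d0 dx *.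
set M := (p + ups / 2 * q) ^+ 2 / 2.
have M0 : 0 <= M by rewrite divr_ge0// sqr_ge0.
have r2 : 0 <= r ^+ 2 <= 1 by rewrite sqr_ge0 exprn_ile1.
have r4 : r ^+ 4 <= r ^+ 2 by rewrite -[4%N]/(2 * 2)%N exprM; nra.
have -> : th' * hamiltonian ups (r * p) (r * q) + (th' * r * (p + ups / 2 * q)) ^+ 2 * x / (2 * d)
  = th' * (r ^+ 2 * M / d + r ^+ 4 * (q ^+ 4 / 4) - r ^+ 2 * (ups ^+ 2 * q ^+ 2 / 8)).
  by rewrite /hamiltonian /M /d; field; rewrite gt_eqF.
have -> : th = th' * expR x by rewrite th'E -mulrA -expRD addNr expR0 mulr1.
have -> : hamiltonian ups p q = M + q ^+ 4 / 4 - ups ^+ 2 * q ^+ 2 / 8.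
  by rewrite /hamiltonian /M; field.
set E := expR x.
have E1 : 1 <= E by rewrite -expR0 ler_expR.
have MM : r ^+ 2 * M / d <= E * M.
  rewrite mulrAC ler_wpM2r// (le_trans _ dx)// ler_piMl ?invr_ge0 ?(ltW d0)//.
  by case/andP: r2.
set S := q ^+ 4 / 4; set V := ups ^+ 2 * q ^+ 2 / 8.
have S0 : 0 <= S by rewrite divr_ge0// exprn_even_ge0.
have VS : V - S <= ups ^+ 4 / 64.
  rewrite -subr_ge0 [leRHS](_ : _ = (q ^+ 2 / 2 - ups ^+ 2 / 8) ^+ 2) ?sqr_ge0//.
  by rewrite /V /S; field.
have gap0 : 0 <= E - r ^+ 2 by lra.
(* [th' * expR x = th <= 1], and both [r ^+ 2] and [expR (- x)] are [1 - O(h)] *)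
have gap : th' * (E - r ^+ 2) <= (sigma ^+ 2 + ups) * h.
  have -> : th' * (E - r ^+ 2) = th * (1 - r ^+ 2 * expR (- x)).
    by rewrite th'E mulrBr -mulrA -expRD addNr expR0; ring.
  have ex1 : 1 - x <= expR (- x) by exact: expR_ge1Dx.
  apply: (@le_trans _ _ (1 - r ^+ 2 * expR (- x))).
    by rewrite ler_piMl// subr_ge0 mulr_ile1 ?(ltW e0)//; [lra|lra|rewrite -expR0 ler_expR; lra].
  have : r ^+ 2 * (1 - x) <= r ^+ 2 * expR (- x) by rewrite ler_wpM2l//; lra.
  have : r ^+ 2 * x <= x by rewrite ler_piMl//; lra.
  by rewrite /x; lra.
have u4 : 0 <= ups ^+ 4 / 64 by rewrite divr_ge0// exprn_ge0// ltW.
have E4 : th' * ((E - r ^+ 2) * (V - S)) <= (sigma ^+ 2 + ups) * ups ^+ 4 / 64 * h.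
  apply: (@le_trans _ _ (th' * ((E - r ^+ 2) * (ups ^+ 4 / 64)))).
    by rewrite ler_wpM2l// ler_wpM2l.
  by rewrite mulrA (le_trans (ler_wpM2r u4 gap))//; lra.
have : th' * (r ^+ 2 * M / d + r ^+ 4 * S - r ^+ 2 * V) <=
       th' * (E * (M + S - V) + (E - r ^+ 2) * (V - S)).
  rewrite ler_wpM2l//.
  have : r ^+ 4 * S <= r ^+ 2 * S by rewrite ler_wpM2r.
  by lra.
by lra.
Qed.

End hamiltonian_step.

(** * Euler schemes along a path of a linear equation *)

Section euler_scheme.
Context {R : realType}.
Implicit Types (a s t u v h e x : R) (X w : R -> R).
Local Notation mu := (@lebesgue_measure R).

(** Heine-Cantor, with the modulus read as a property that holds for all small
    enough positive [h]: around each point of [A] continuity gives such an [h],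
    and compactness makes the choice uniform. *)
Lemma within_continuous_unif X (A : set R) e : compact A ->
  {within A, continuous X} -> 0 < e ->
  \forall h \near 0^'+, forall u v, A u -> A v -> `|u - v| <= h ->
    `|X u - X v| <= e.
Proof.
move=> cA /subspace_continuousP cX e0.
have /compact_near_coveringP/near_covering_withinP cov := cA.
suff : \forall h \near (0 : R)^'+,
    A `<=` (fun u => forall v, A v -> `|u - v| <= h -> `|X u - X v| <= e).
  by apply: filterS => h P u v Au; exact: P.
apply: cov => c Ac.
have /cvgrPdist_lt/(_ (e / 2)) := cX _ Ac.
rewrite divr_gt0// => /(_ isT); rewrite /within/= => -[d/= d0 dP].
exists (ball c (d / 2), [set h | h < d / 2]).
  split; first by apply: nbhsx_ballx; rewrite divr_gt0.
  by apply: nbhs_right_lt; rewrite divr_gt0.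
move=> [u h]/= [cu hd] Au v Av uvh.
rewrite /ball/= in cu.
have := dP u _ Au; rewrite /ball/= => /(_ _)/ltW.
have := dP v _ Av; rewrite /ball/= => /(_ _)/ltW.
have cv : `|c - v| < d.
  by rewrite -(subrKA u) (le_lt_trans (ler_normD _ _))//; lra.
have cu' : `|c - u| < d by lra.
move=> /(_ cv) Xcv /(_ cu') Xcu.
by rewrite -(subrKA (X c)) (le_trans (ler_normD _ _))// (distrC (X u)); lra.
Qed.

(** The linear equation along a single trajectory: [w] stands for one path of the
    driving noise, [x] for the starting point. *)
Definition solves_linear_path a s t0 t1 x w X : Prop :=
  {within `[t0, t1], continuous X} /\
  forall t, t0 <= t <= t1 ->
    X t = x + \int[mu]_(r in `[t0, t]) (a * X r) + s * (w t - w t0).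

(** One Euler step follows an exact trajectory up to the oscillation of [X] on
    the step: the defect is the integral of [a * (X r - X u)] for [r] between [u] and
    [v]. The noise enters the equation and the scheme identically and drops out. *)
Lemma linear_path_increment a s t0 t1 x w X e u v :
  solves_linear_path a s t0 t1 x w X ->
  t0 <= u -> u <= v -> v <= t1 ->
  (forall r, u <= r <= v -> `|X r - X u| <= e) ->
  `|X v - ((1 + a * (v - u)) * X u + s * (w v - w u))| <= (v - u) * (`|a| * e).
Proof.
move=> [cX eX] tu uv vt Xe.
have cI p q : t0 <= p -> q <= t1 -> mu.-integrable `[p, q] (EFin \o (fun r => a * X r)).
  move=> tp qt; apply: continuous_compact_integrable; first exact: segment_compact.
  have cpq : {within `[p, q], continuous X}.
    apply: continuous_subspaceW cX => z /=; rewrite !in_itv/= => /andP[? ?].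
    by apply/andP; split; [exact: le_trans tp _|exact: le_trans qt].
  by move=> z; apply: cvgM; [exact: cvg_cst|exact: cpq].
have sub : `]u, v] `<=` `[u, v] by exact: subset_itv_oc_cc.
have iuv : mu.-integrable `]u, v] (EFin \o (fun r => a * X r)).
  by apply: integrableS (cI u v tu vt).
have icst c : mu.-integrable `]u, v] (EFin \o (fun=> c)).
  apply: (@integrableS _ _ _ mu `[u, v]) => //.
  apply: continuous_compact_integrable; first exact: segment_compact.
  by move=> z; exact: cvg_cst.
have muuv : fine (mu `]u, v]) = v - u.
  rewrite lebesgue_measure_itv/= lte_fin; case: ltP => //= vu; lra.
have XvE : X v - X u = \int[mu]_(r in `]u, v]) (a * X r) + s * (w v - w u).
  rewrite (eX v) ?(eX u); [|by apply/andP; split; lra..].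
  rewrite -(@Rintegral_itvB _ (fun r => a * X r) (BLeft t0) (BRight v) u); 
    [ring|by apply: cI|by rewrite bnd_simp|by rewrite bnd_simp].
rewrite (_ : X v - _ = \int[mu]_(r in `]u, v]) (a * X r - a * X u)); last first.
  rewrite RintegralB//= Rintegral_cst//= muuv.
  move: XvE => /eqP; rewrite subr_eq => /eqP ->; ring.
have iB : mu.-integrable `]u, v] (EFin \o (fun r => a * X r - a * X u)).
  have := integrableB _ iuv (icst (a * X u)).
  move=> /(_ (measurable_itv _)); apply: eq_integrable => //.

rewrite (le_trans (le_normr_Rintegral _ iB))//.
rewrite [leRHS](_ : _ = \int[mu]_(r in `]u, v]) (`|a| * e)); last first.
  by rewrite Rintegral_cst//= muuv; ring.
apply: le_Rintegral => //=.
  by have := integrable_norm iB.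
move=> r; rewrite in_itv/= => /andP[ur rv].
rewrite -mulrBr normrM ler_wpM2l// Xe//.
by rewrite (ltW ur).
Qed.

Fixpoint euler a s h t0 w x (n : nat) : R :=
  if n is m.+1 then
    (1 + a * h) * euler a s h t0 w x m
    + s * (w (t0 + m.+1%:R * h) - w (t0 + m%:R * h))
  else x.

(** As [0 <= 1 + a * h <= 1], a step does not enlarge the error made so far, so
    the local defects just add up. *)
Lemma euler_error a s t0 t1 x w X h e (N : nat) :
  solves_linear_path a s t0 t1 x w X ->
  0 <= h -> t0 + N%:R * h <= t1 -> 0 <= 1 + a * h <= 1 ->
  (forall u v, `[t0, t1]%classic u -> `[t0, t1]%classic v -> `|u - v| <= h ->
    `|X u - X v| <= e) ->
  forall n, (n <= N)%N ->
  `|X (t0 + n%:R * h) - euler a s h t0 w x n| <= n%:R * (h * (`|a| * e)).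
Proof.
move=> sX h0 hN /andP[ah0 ah1] Xe; elim=> [_|n IH nN].
  have t01 : t0 <= t1 by rewrite (le_trans _ hN)// lerDl mulr_ge0.
  have [_ eX] := sX.
  by rewrite !mul0r addr0 /= eX ?lexx// set_itv1 Rintegral_set1
    !subrr mulr0 !addr0 subrr normr0.
have {}IH := IH (ltnW nN).
set u := t0 + n%:R * h in IH *; set v := t0 + n.+1%:R * h.
have vu : v - u = h by rewrite /u /v -natr1; ring.
have tu : t0 <= u by rewrite lerDl mulr_ge0.
have vt : v <= t1 by rewrite (le_trans _ hN)// lerD2l ler_wpM2r// ler_nat.
have uv : u <= v by lra.
have := @linear_path_increment a s t0 t1 x w X e u v sX tu uv vt.
rewrite vu => inc.
have Xr r : u <= r <= v -> `|X r - X u| <= e.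
  move=> /andP[ur rv]; apply: Xe; rewrite /= ?in_itv/=.
  - by apply/andP; split; lra.
  - by apply/andP; split; lra.
  - by rewrite ger0_norm; lra.
have {}inc := inc Xr.
rewrite [X in `|X|](_ : _ = (X v - ((1 + a * h) * X u + s * (w v - w u)))
  + (1 + a * h) * (X u - euler a s h t0 w x n)); last by rewrite /=; ring.
rewrite (le_trans (ler_normD _ _))// -natr1 [leRHS]mulrDl mul1r [leRHS]addrC lerD//.
by rewrite normrM (ger0_norm ah0) (le_trans _ IH)// ler_piMl.
Qed.

(** The total error is at most [(t1 - t0) * |a|] times the modulus of continuity
    of [X] at the step size, which tends to zero. *)
Lemma euler_cvg a s t0 t1 x w X : t0 < t1 -> a <= 0 ->
  solves_linear_path a s t0 t1 x w X ->
  euler a s ((t1 - t0) / n.+1%:R) t0 w x n.+1 @[n --> \oo] --> X t1.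
Proof.
move=> t01 a0 sX.
pose h n : R := (t1 - t0) / n.+1%:R.
have h_gt0 n : 0 < h n by rewrite divr_gt0// subr_gt0.
have hcvg : h n @[n --> \oo] --> (0 : R)^'+.
  have h0 : h n @[n --> \oo] --> (0 : R).
    rewrite -(mulr0 (t1 - t0)); apply: cvgM; first exact: cvg_cst.
    exact: (@cvg_harmonic R).
  move=> B /= B0; have : \forall n \near \oo, 0 < h n -> B (h n) by exact: h0 _ B0.
  by apply: filterS => n /(_ (h_gt0 n)).
apply/cvgrPdist_le => e e0.
pose C := (t1 - t0) * `|a| + 1.
have C0 : 0 < C by rewrite ltr_wpDl// mulr_ge0// subr_ge0 ltW.
have [cX _] := sX.
have unif := within_continuous_unif (@segment_compact R t0 t1) cX (divr_gt0 e0 C0).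
have small : \forall h \near (0 : R)^'+, 0 <= 1 + a * h <= 1.
  near=> k.
  have k0 : 0 < k by near: k; exact: nbhs_right_gt.
  have : k < (1 - a)^-1 by near: k; apply: nbhs_right_lt; rewrite invr_gt0; lra.
  rewrite -[ltRHS]mul1r ltr_pdivlMr; last lra.
  by nra.
near=> n.
have P : forall u v, `[t0, t1]%classic u -> `[t0, t1]%classic v ->
    `|u - v| <= h n -> `|X u - X v| <= e / C.
  by near: n; exact: hcvg _ unif.
have Q : 0 <= 1 + a * h n <= 1 by near: n; exact: hcvg _ small.
have hN : n.+1%:R * h n = t1 - t0 by rewrite /h mulrC divfK.
have := @euler_error a s t0 t1 x w X (h n) (e / C) n.+1 sX (ltW (h_gt0 n)) _ Q P n.+1 (leqnn _).
rewrite hN subrKC => /(_ (lexx _))/le_trans; apply.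
rewrite mulrA hN mulrA mulrA ler_pdivrMr// [leRHS]mulrC ler_wpM2r ?(ltW e0)//.
by rewrite /C lerDl.
Unshelve. all: by end_near.
Qed.

End euler_scheme.

(** * Integration against independent variables *)

Section independence.
Context {R : realType}.

(** Measurability with respect to a sub-sigma-algebra given as a set of sets is
    measurability on a copy of the type that carries it, so the closure
    properties of [measurable_fun] become available. *)
Lemma sub_sigma_algebra_measurableP {T : pointedType} (G : set (set T))
    d' (S : measurableType d') (Z : T -> S) :
  sigma_algebra setT G ->
  (forall B, measurable B -> G (Z @^-1` B)) <->
  measurable_fun setT (Z : g_sigma_algebraType G -> S).
Proof.
move=> sG; split=> [GZ _ B mB|mZ B mB].
  by rewrite setTI /measurable/= sigma_algebra_id//; exact: GZ.
by have := mZ measurableT B mB; rewrite setTI /measurable/= sigma_algebra_id.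
Qed.

(** The substitute for conditional expectation: when [V] is independent of [G] and
    [Z] is [G]-measurable, the joint law of [(Z, V)] is the product of the two
    laws, because they agree on rectangles; Tonelli's theorem then integrates
    out [V] with [Z] frozen. *)
Lemma independent_integral d (Om : measurableType d) (P : probability Om R)
    (G : set (set Om)) d1 (T1 : measurableType d1) d2 (T2 : measurableType d2)
    (Z : Om -> T1) (V : Om -> T2) (nu : probability T2 R) (f : T1 * T2 -> \bar R) :
  G `<=` measurable ->
  (forall A, measurable A -> G (Z @^-1` A)) ->
  measurable_fun setT V ->
  (forall B, measurable B -> P (V @^-1` B) = nu B) ->
  (forall A B, G A -> measurable B ->
    P (A `&` V @^-1` B) = (P A * P (V @^-1` B))%E) ->
  measurable_fun setT f -> (forall z, 0 <= f z)%E ->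
  (\int[P]_w f (Z w, V w) = \int[P]_w \int[nu]_v f (Z w, v))%E.
Proof.
move=> Gm GZ mV PV ind mf f0.
have mZ : measurable_fun setT Z by move=> _ B mB; rewrite setTI; exact/Gm/GZ.
have mZV : measurable_fun setT (fun w => (Z w, V w)) by exact: measurable_fun_pair.
pose ZR : {RV P >-> T1} := HB.pack Z (isMeasurableFun.Build _ _ _ _ _ mZ).
pose ZVR : {RV P >-> (T1 * T2)%type} := 
  HB.pack (fun w => (Z w, V w)) (isMeasurableFun.Build _ _ _ _ _ mZV).
have -> : (\int[P]_w f (Z w, V w) = \int[distribution P ZVR]_z f z)%E.
  by rewrite (ge0_integral_distribution ZVR mf f0).
have -> : (\int[distribution P ZVR]_z f z =
           \int[distribution P ZR \x nu]_z f z)%E.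
  apply: eq_measure_integral => A mA _; apply/esym.
  apply: product_measure_unique => // B C mB mC.
  by rewrite /= /distribution /pushforward/= -PV// -ind//; exact: GZ.
rewrite fubini_tonelli1//.
by rewrite ge0_integral_distribution//;
  [exact: measurable_fun_fubini_tonelli_F|move=> y; exact: integral_ge0].
Qed.

End independence.

(** * The conditional one-step estimate *)

Section one_step.
Context {R : realType}.
Implicit Types (ups sigma h r th p q : R).

(** The two summands are the costs of a step per unit of time: the normalising
    factor of the Gaussian integral, and the error term of [energy_step]. *)
Definition growth_rate ups sigma : R :=
  sigma ^+ 2 / 2 + (sigma ^+ 2 + ups) * ups ^+ 4 / 64.

Lemma hamiltonian_shift ups p q y :
  hamiltonian ups (p + y) q =
  hamiltonian ups p q + (p + ups / 2 * q) * y + y ^+ 2 / 2.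
Proof. by rewrite /hamiltonian; field. Qed.

Lemma measurable_hamiltonian d (T : measurableType d) ups (f g : T -> R) :
  measurable_fun setT f -> measurable_fun setT g ->
  measurable_fun setT (fun x => hamiltonian ups (f x) (g x)).
Proof.
move=> mf mg; rewrite /hamiltonian.
apply: measurable_funD; [apply: measurable_funD|].
- by apply: measurable_funM => //; exact: measurable_funX.
- by apply: measurable_funM => //; exact: measurable_funX.
- by apply: measurable_funM => //; exact: measurable_funM.
Qed.

(** Conditional one-step estimate: with [(p, q)] frozen, the shifted Hamiltonian is
    a quadratic polynomial in the increment [y], so the expectation is the
    explicit Gaussian integral and [energy_step] bounds its exponent. The factor
    [(1 - th' sigma^2 h)^(-1/2)] is at most [expR (sigma^2 h / 2)]. *)
Lemma normal_energy_step ups sigma h r th th' p q :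
  0 < ups -> 0 < h -> 0 <= r <= 1 -> 1 - ups * h <= r ^+ 2 ->
  0 <= th <= 1 -> th' = th * expR (- (sigma ^+ 2 * h)) ->
  (\int[normal_prob 0 (Num.sqrt h)]_y
     (expR (th' * hamiltonian ups (r * p + sigma * y) (r * q)))%:E
   <= (expR (growth_rate ups sigma * h) * expR (th * hamiltonian ups p q))%:E)%E.
Proof.
move=> u0 h0 r01 rh th01 th'E.
have x0 : 0 <= sigma ^+ 2 * h by rewrite mulr_ge0 ?sqr_ge0// ltW.
have th'x : th' <= expR (- (sigma ^+ 2 * h)).
  by rewrite th'E ler_piMl ?expR_ge0//; case/andP: th01.
have [d0 dx] := variance_factor_le x0 th'x.
have energy := @energy_step R ups sigma h r th th' p q u0 h0 r01 rh th01 th'E.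
set L := p + ups / 2 * q in energy.
under eq_integral => y _.
  rewrite (_ : th' * _ = th' * hamiltonian ups (r * p) (r * q) +
     (th' * r * L * sigma * y + th' * sigma ^+ 2 * y ^+ 2 / 2)); last first.
    by rewrite hamiltonian_shift /L; field.
  rewrite expRD EFinM.
  over.
rewrite ge0_integralZl//; last first.
- apply/measurable_EFinP; apply: measurableT_comp => //.
  apply: measurable_funD; first exact: measurable_funM.
  by apply: measurable_funM => //; apply: measurable_funM => //; exact: measurable_funX.
rewrite integral_normal_prob_expR_quad//; last by rewrite -mulrA; lra.
rewrite -EFinM lee_fin mulrA -expRD -expRD.
rewrite (_ : (th' * r * L * sigma) ^+ 2 * h / (2 * (1 - th' * sigma ^+ 2 * h)) =
  (th' * r * L) ^+ 2 * (sigma ^+ 2 * h) / (2 * (1 - th' * (sigma ^+ 2 * h)))); last first.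
  by rewrite (mulrA th'); congr (_ / _); ring.
have sq : (Num.sqrt (1 - th' * sigma ^+ 2 * h))^-1 <= expR (sigma ^+ 2 * h / 2).
  rewrite -mulrA -sqrtrV ?(ltW d0)// -[leRHS]ger0_norm ?expR_ge0// -sqrtr_sqr.
  by rewrite ler_wsqrtr// -expRM_natl [2 * _]mulrC divfK.
apply: (@le_trans _ _ (expR (th * hamiltonian ups p q +
    (sigma ^+ 2 + ups) * ups ^+ 4 / 64 * h) * expR (sigma ^+ 2 * h / 2))).
  by rewrite ler_pM ?expR_ge0 ?invr_ge0 ?sqrtr_ge0// ler_expR.
by rewrite -expRD ler_expR /growth_rate; lra.
Qed.

End one_step.

(** * Discounted energy moments along the stochastic step *)

Section stochastic_step.
Context {R : realType} d (Om : measurableType d) (P : probability Om R).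
Variables (F : R -> set (set Om)) (W : R -> Om -> R).
Hypotheses (filF : is_filtration F) (wienW : is_wiener P F W).
Variables (ups sigma : R).
Hypothesis (ups_gt0 : 0 < ups).
Implicit Types (t u v h r : R) (X Y Z : Om -> R).

Definition adapted_at t Y := forall B : set R, measurable B -> F t (Y @^-1` B).

Definition discount t : R := expR (- (sigma ^+ 2 * t)).

Definition energy_moment t Y Z : \bar R :=
  (\int[P]_w (expR (discount t * hamiltonian ups (Y w) (Z w)))%:E)%E.

Lemma adapted_atP t Y : 0 <= t ->
  adapted_at t Y <-> measurable_fun setT (Y : g_sigma_algebraType (F t) -> R).
Proof.
by have [sF _ _] := filF => t0; apply: sub_sigma_algebra_measurableP; exact: sF.
Qed.

Lemma adapted_at_le t u Y : 0 <= t -> t <= u -> adapted_at t Y -> adapted_at u Y.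
Proof. by have [_ _ mF] := filF => t0 tu FY B mB; apply: (mF t) => //; exact: FY. Qed.

Lemma adapted_at_measurable t Y : 0 <= t -> adapted_at t Y -> measurable_fun setT Y.
Proof.
have [_ Fm _] := filF => t0 FY _ B mB; rewrite setTI; apply: (Fm t) => //; exact: FY.
Qed.

Lemma adapted_at_wiener t : 0 <= t -> adapted_at t (W t).
Proof.
by move=> t0 B mB; apply: (wiener_adapted wienW) => //=; rewrite in_itv/= t0.
Qed.

Lemma measurable_energy t Y Z : measurable_fun setT Y -> measurable_fun setT Z ->
  measurable_fun setT (fun w => (expR (discount t * hamiltonian ups (Y w) (Z w)))%:E).
Proof.
move=> mY mZ; apply/measurable_EFinP; apply: measurableT_comp => //.
by apply: measurable_funM => //; exact: measurable_hamiltonian.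
Qed.

(** [(Y, Z)] is known at time [u] and the increment of [W] is independent of the
    past, so the conditional estimate can be integrated over the law of [(Y, Z)].
    The discount at time [v] is the one at time [u] times the decay over the
    step, which is the form that [normal_energy_step] expects. *)
Lemma energy_moment_increment u v r Y Z : 0 <= u -> u < v ->
  0 <= r <= 1 -> 1 - ups * (v - u) <= r ^+ 2 ->
  adapted_at u Y -> adapted_at u Z ->
  (energy_moment v (fun w => r * Y w + sigma * (W v w - W u w))%R
     (fun w => r * Z w)%R
   <= (expR (growth_rate ups sigma * (v - u)))%:E * energy_moment u Y Z)%E.
Proof.
move=> u0 uv r01 rh FY FZ.
have h0 : 0 < v - u by rewrite subr_gt0.
have v0 : 0 <= v by rewrite (le_trans u0)// ltW.
have [sF Fm _] := filF.
have mY := adapted_at_measurable u0 FY; have mZ := adapted_at_measurable u0 FZ.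
have mW t : 0 <= t -> measurable_fun setT (W t).
  by move=> t0; exact: adapted_at_measurable t0 (adapted_at_wiener t0).
pose f (z : (R * R) * g_sigma_algebraType (R.-ocitv.-measurable)) : \bar R :=
  (expR (discount v * hamiltonian ups (r * z.1.1 + sigma * z.2) (r * z.1.2)))%:E.
have mf : measurable_fun setT f.
  apply/measurable_EFinP; apply: measurableT_comp => //.
  apply: measurable_funM => //; apply: measurable_hamiltonian.
    apply: measurable_funD; apply: measurable_funM => //.
    by apply: measurableT_comp.
  by apply: measurable_funM => //; apply: measurableT_comp.
have := @independent_integral R d Om P (F u) _ _ _ (g_sigma_algebraType (R.-ocitv.-measurable))
  (fun w => (Y w, Z w))
  (fun w => W v w - W u w) (normal_prob 0 (Num.sqrt (v - u))) f (Fm _ u0) _ _ _ _ mf _.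
rewrite /f/= /energy_moment => ->; first last.
- by move=> z; rewrite lee_fin expR_ge0.
- by move=> A B FA mB; exact: (wiener_indep wienW u0 uv FA mB).
- by move=> B mB; exact: (wiener_normal wienW u0 uv mB).
- by apply: measurable_funB; exact: mW.
- apply/sub_sigma_algebra_measurableP; first exact: sF.
  by apply: measurable_fun_pair; apply/adapted_atP.
have th01 : 0 <= discount u <= 1.
  by rewrite expR_ge0/= -expR0 ler_expR oppr_le0 mulr_ge0 ?sqr_ge0.
have thE : discount v = discount u * expR (- (sigma ^+ 2 * (v - u))).
  by rewrite -expRD; congr expR; ring.
rewrite -ge0_integralZl//; last exact: measurable_energy.
apply: ge0_le_integral => //.
- by move=> w _; apply: integral_ge0 => y _; rewrite lee_fin expR_ge0.
- have mF : measurable_fun setT (fubini_F (normal_prob 0 (Num.sqrt (v - u))) f).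
    by apply: measurable_fun_fubini_tonelli_F => // z; rewrite lee_fin expR_ge0.
  have mYZ : measurable_fun setT (fun w => (Y w, Z w)).
    exact: measurable_fun_pair.
  exact: measurableT_comp mF mYZ.
- by apply: measurable_funeM; exact: measurable_energy.
- by move=> w _; rewrite -EFinM; exact: normal_energy_step.
Qed.

(** The scheme at step [n] only reads [W] up to the time of that step, which is
    what keeps the next increment independent of it. *)
Lemma adapted_at_euler a s h t (Y : Om -> R) (n : nat) : 0 <= t -> 0 <= h ->
  adapted_at t Y ->
  adapted_at (t + n%:R * h) (fun w => euler a s h t (W^~ w) (Y w) n).
Proof.
move=> t0 h0 FY; elim: n => [|n IH]; first by rewrite mul0r addr0.
have tn0 k : 0 <= t + k%:R * h by rewrite addr_ge0// mulr_ge0.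
have le_n : t + n%:R * h <= t + n.+1%:R * h by rewrite lerD2l ler_wpM2r// ler_nat.
apply/(adapted_atP _ (tn0 _)) => /=.
apply: measurable_funD; apply: measurable_funM => //.
  by apply/(adapted_atP _ (tn0 _)); apply: adapted_at_le le_n _.
apply: measurable_funB; apply/(adapted_atP _ (tn0 _)).
  exact: adapted_at_wiener.
by apply: adapted_at_le le_n _ => //; exact: adapted_at_wiener.
Qed.

Lemma energy_moment_euler (h t : R) Y Z (n : nat) : 0 <= t -> 0 < h ->
  0 <= 1 + - (ups / 2) * h ->
  adapted_at t Y -> adapted_at t Z ->
  (energy_moment (t + n%:R * h)
     (fun w => euler (- (ups / 2)) sigma h t (W^~ w) (Y w) n)
     (fun w => euler (- (ups / 2)) 0 h t (W^~ w) (Z w) n)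
   <= (expR (growth_rate ups sigma * (n%:R * h)))%:E * energy_moment t Y Z)%E.
Proof.
move=> t0 h0 r0 FY FZ; elim: n => [|n IH].
  by rewrite mul0r mulr0 expR0 mul1e addr0.
have tn0 k : 0 <= t + k%:R * h by rewrite addr_ge0// mulr_ge0// ltW.
set u := t + n%:R * h in IH; set v := t + n.+1%:R * h.
have vu : v - u = h by rewrite /u /v -natr1; ring.
have uv : u < v by rewrite -subr_gt0 vu.
have r01 : 0 <= 1 + - (ups / 2) * h <= 1.
  by rewrite r0/= gerDl mulNr oppr_le0 mulr_ge0 ?divr_ge0// ltW.
(* the difference of the two sides is the square (ups h / 2)^2 *)
have rh : 1 - ups * (v - u) <= (1 + - (ups / 2) * h) ^+ 2.
  rewrite vu -subr_ge0 [leRHS](_ : _ = (ups / 2 * h) ^+ 2) ?sqr_ge0//; by field.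
have := @energy_moment_increment u v _ _ _ (tn0 n) uv r01 rh
  (adapted_at_euler (- (ups / 2)) sigma n t0 (ltW h0) FY)
  (adapted_at_euler (- (ups / 2)) 0 n t0 (ltW h0) FZ).
rewrite vu => step.
apply: (@le_trans _ _ ((expR (growth_rate ups sigma * h))%:E *
  ((expR (growth_rate ups sigma * (n%:R * h)))%:E * energy_moment t Y Z))%E); last first.
  by rewrite muleA -EFinM -expRD -natr1
    (_ : _ * h + _ = growth_rate ups sigma * ((n%:R + 1) * h))//; ring.
apply: le_trans (lee_wpmul2l _ IH); last by rewrite lee_fin expR_ge0.
apply: le_trans step; rewrite le_eqVlt; apply/orP; left; apply/eqP.
congr (energy_moment _ _ _); apply/funext => w //=.
by rewrite mul0r addr0.
Qed.

(** An almost sure limit inherits an eventual bound on expectations: only this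
    inequality is required in the limit, so no domination has to be found for
    the exponential of a quartic. *)
Lemma fatou_le (f : nat -> Om -> R) (g : Om -> R) (C : \bar R) :
  (forall n, measurable_fun setT (f n)) -> measurable_fun setT g ->
  (forall n w, 0 <= f n w) -> (forall w, 0 <= g w) ->
  {ae P, forall w, f n w @[n --> \oo] --> g w} ->
  (\forall n \near \oo, (\int[P]_w (f n w)%:E <= C)%E) ->
  (\int[P]_w (g w)%:E <= C)%E.
Proof.
move=> mf mg f0 g0 fg fC.
have mEf n : measurable_fun setT (EFin \o f n) by exact/measurable_EFinP.
have Ef0 n w : setT w -> (0 <= (EFin \o f n) w)%E by move=> _; rewrite lee_fin.
have limE w : limn_einf (fun n => (f n w)%:E) = limn (einfs (fun n => (f n w)%:E)).
  exact: limn_einf_lim.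
apply: (@le_trans _ _ (\int[P]_w limn_einf (fun n => (f n w)%:E))%E); last first.
  apply: le_trans (fatou P measurableT mEf Ef0) _.
  rewrite limn_einf_lim; apply: lime_le; first exact: is_cvg_einfs.
  apply: filterS fC => n; apply: le_trans.
  by apply: ereal_inf_lbound; exists n => /=.
apply: ae_ge0_le_integral => //.
- by move=> w _; rewrite lee_fin.
- exact/measurable_EFinP.
- move=> w _; rewrite limE; apply: lime_ge; first exact: is_cvg_einfs.
  by apply: nearW => n; apply: le_ereal_inf_tmp => _ [m _ <-]; rewrite lee_fin.
- apply: (emeasurable_fun_cvg (fun n w => einfs (fun n => (f n w)%:E) n)).
    by move=> n; exact: (measurable_fun_einfs mEf).
  by move=> w _; rewrite limE; exact: is_cvg_einfs.
- apply: filterS fg => w fgw _.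
  have fgE : (f n w)%:E @[n --> \oo] --> (g w)%:E.
    by apply/fine_cvgP; split; [exact: nearW|exact: fgw].
  have [-> _] := cvg_limn_einf_sup fgE; exact: lexx.
Qed.

(** The exact solution of the stochastic step is the almost sure limit of Euler
    schemes driven by increments of [W], for which the moment bound is uniform
    in the number of steps. In this way the law of the stochastic convolution
    is never computed. *)
Lemma energy_moment_sde (t0 t1 : R) (Y Z : Om -> R) (X V : R -> Om -> R) :
  0 <= t0 -> t0 < t1 -> adapted_at t0 Y -> adapted_at t0 Z ->
  solves_linear_sde P F W (- (ups / 2)) sigma t0 t1 Y X ->
  solves_linear_sde P F W (- (ups / 2)) 0 t0 t1 Z V ->
  (energy_moment t1 (X t1) (V t1)
   <= (expR (growth_rate ups sigma * (t1 - t0)))%:E * energy_moment t0 Y Z)%E.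
Proof.
move=> t00 t01 FY FZ [FX solX] [FV solV].
have t10 : 0 <= t1 by rewrite (le_trans t00)// ltW.
have FXt : adapted_at t1 (X t1) by apply: FX; rewrite /= in_itv/= lexx ltW.
have FVt : adapted_at t1 (V t1) by apply: FV; rewrite /= in_itv/= lexx ltW.
pose a := - (ups / 2).
have a0 : a <= 0 by rewrite oppr_le0 divr_ge0// ltW.
pose h n : R := (t1 - t0) / n.+1%:R.
have h_gt0 n : 0 < h n by rewrite divr_gt0// subr_gt0.
have hE n : t0 + n.+1%:R * h n = t1 by rewrite mulrC divfK// subrKC.
pose Xn n w := euler a sigma (h n) t0 (W^~ w) (Y w) n.+1.
pose Vn n w := euler a 0 (h n) t0 (W^~ w) (Z w) n.+1.
have FXn n : adapted_at t1 (Xn n).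
  by rewrite -(hE n); apply: adapted_at_euler => //; exact: ltW.
have FVn n : adapted_at t1 (Vn n).
  by rewrite -(hE n); apply: adapted_at_euler => //; exact: ltW.
apply: (@fatou_le (fun n w => expR (discount t1 * hamiltonian ups (Xn n w) (Vn n w)))).
- move=> n; apply/measurable_EFinP; apply: measurable_energy.
  + exact: adapted_at_measurable t10 (FXn n).
  + exact: adapted_at_measurable t10 (FVn n).
- apply/measurable_EFinP; apply: measurable_energy.
  + exact: adapted_at_measurable t10 FXt.
  + exact: adapted_at_measurable t10 FVt.
- by move=> n w; exact: expR_ge0.
- by move=> w; exact: expR_ge0.
- apply: filterS2 solX solV => w [cX eX] [cV eV].
  have cvX : Xn n w @[n --> \oo] --> X t1 w.
    by apply: (@euler_cvg _ a sigma t0 t1 (Y w) (W^~ w) (X^~ w)); last split.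
  have cvV : Vn n w @[n --> \oo] --> V t1 w.
    by apply: (@euler_cvg _ a 0 t0 t1 (Z w) (W^~ w) (V^~ w)); last split.
  apply: (cvg_comp _ expR); last exact: continuous_expR.
  apply: cvgM; first exact: cvg_cst.
  rewrite /hamiltonian; apply: cvgD; [apply: cvgD|].
  + by apply: cvgM; [exact: (cvg_comp _ _ cvX (@exprn_continuous R 2 _))|exact: cvg_cst].
  + by apply: cvgM; [exact: (cvg_comp _ _ cvV (@exprn_continuous R 4 _))|exact: cvg_cst].
  + by apply: cvgM => //; apply: cvgM => //; exact: cvg_cst.
- near=> n.
  have r0 : 0 <= 1 + a * h n.
    (* the step must be short enough for the damping factor to be nonnegative *)
    have nbig : ups / 2 * (t1 - t0) <= n%:R by near: n; exact: nbhs_infty_ger.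
    rewrite /a mulNr subr_ge0 /h mulrA ler_pdivrMr// mul1r (le_trans nbig)//.
    by rewrite ler_nat.
  have := energy_moment_euler n.+1 t00 (h_gt0 n) r0 FY FZ.
  by rewrite hE (_ : n.+1%:R * h n = t1 - t0)// -(hE n); ring.
Unshelve. all: by end_near.
Qed.

End stochastic_step.

(** * The splitting scheme *)

Section splitting.
Context {R : realType} d (Om : measurableType d) (P : probability Om R).
Variables (F : R -> set (set Om)) (W : R -> Om -> R).
Hypotheses (filF : is_filtration F) (wienW : is_wiener P F W).
Variables (ups sigma tau : R).
Hypotheses (ups_gt0 : 0 < ups) (tau_gt0 : 0 < tau).
Variables (AA BB : R * R * R * R -> R) (psi phi : R * R -> R) (p0 q0 : R).
Variables (Pn Qn Pb Qb : nat -> Om -> R) (Pt Qt : nat -> R -> Om -> R).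
Hypotheses (mpsi : measurable_fun setT psi) (mphi : measurable_fun setT phi).
Hypothesis split : is_splitting P F W ups sigma tau AA BB psi phi p0 q0
  Pn Qn Pb Qb Pt Qt.

Lemma grid_ge0 n : 0 <= grid tau n.
Proof. by rewrite mulr_ge0// ltW. Qed.

Lemma grid_lt n : grid tau n < grid tau n.+1.
Proof. by rewrite ltr_pM2r// ltr_nat. Qed.

Lemma adapted_at_comp2 (t : R) (g : R * R -> R) (X Y Z : Om -> R) : 0 <= t ->
  measurable_fun setT g -> (forall w, Z w = g (X w, Y w)) ->
  adapted_at F t X -> adapted_at F t Y -> adapted_at F t Z.
Proof.
move=> t0 mg ZE /(adapted_atP filF _ t0) FX /(adapted_atP filF _ t0) FY.
apply/(adapted_atP filF _ t0).
have -> : Z = g \o (fun w => (X w, Y w)) by apply/funext => w; rewrite ZE.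
by apply: measurableT_comp => //; exact: measurable_fun_pair.
Qed.

Lemma splitting_adapted n :
  adapted_at F (grid tau n) (Pn n) /\ adapted_at F (grid tau n) (Qn n).
Proof.
have lt := grid_lt n.
case: n lt => [_|n _].
  by split; apply/(adapted_atP filF _ (grid_ge0 0));
    rewrite (funext (split_P0 split), funext (split_Q0 split)); exact: measurable_cst.
have [FP _] := split_stoP split n; have [FQ _] := split_stoQ split n.
have In : `[grid tau n, grid tau n.+1]%classic (grid tau n.+1).
  by rewrite /= in_itv/= lexx ltW// grid_lt.
by split; [rewrite (funext (split_nextP split n)); exact: FP|
           rewrite (funext (split_nextQ split n)); exact: FQ].
Qed.

(** The deterministic step leaves the Hamiltonian unchanged at every sample, hence
    also its discounted moment; the stochastic step multiplies the moment by at
    most [expR (growth_rate * tau)]. *)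
Lemma splitting_energy_moment n :
  (energy_moment P ups sigma (grid tau n) (Pn n) (Qn n)
   <= (expR (growth_rate ups sigma * grid tau n + hamiltonian ups p0 q0))%:E)%E.
Proof.
elim: n => [|n IH].
  rewrite /energy_moment (funext (split_P0 split)) (funext (split_Q0 split)).
  rewrite integral_cst// /grid mul0r mulr0 add0r /discount mulr0 oppr0 expR0 mul1r.
  rewrite [X in (_ * X)%E](_ : _ = 1%E) ?mule1//; exact: probability_setT.
have [FP FQ] := splitting_adapted n.
have FPb : adapted_at F (grid tau n) (Pb n).
  exact: (adapted_at_comp2 (grid_ge0 n) mpsi (split_psi split n)).
have FQb : adapted_at F (grid tau n) (Qb n).
  exact: (adapted_at_comp2 (grid_ge0 n) mphi (split_phi split n)).
have := energy_moment_sde filF wienW ups_gt0 (grid_ge0 n) (grid_lt n) FPb FQb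
  (split_stoP split n) (split_stoQ split n).
rewrite -(funext (split_nextP split n)) -(funext (split_nextQ split n)).
move=> /le_trans; apply.
rewrite [energy_moment _ _ _ _ (Pb n) _](_ : _ =
  energy_moment P ups sigma (grid tau n) (Pn n) (Qn n)); last first.
  by apply: eq_integral => w _; rewrite (split_energy split).
apply: (le_trans (lee_wpmul2l _ IH)); first by rewrite lee_fin expR_ge0.
by rewrite -EFinM -expRD addrA -mulrDr subrK.
Qed.

End splitting.

Theorem proposition2p3 (R : realType) (ups sigma Ce : R)
    (ups_gt0 : 0 < ups) (sigma_gt0 : 0 < sigma)
    (Ce_adm : energy_constant ups Ce) :
  exists2 C : R, 0 < C &
    forall (d : measure_display) (Om : measurableType d)
      (P : probability Om R) (F : R -> set (set Om)) (W : R -> Om -> R)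
      (tau : R) (AA BB : R * R * R * R -> R) (psi phi : R * R -> R)
      (p0 q0 : R) (Pn Qn Pb Qb : nat -> Om -> R)
      (Pt Qt : nat -> R -> Om -> R),
    measure_is_complete P ->
    is_filtration F ->
    is_wiener P F W ->
    0 < tau < 1 ->
    measurable_fun setT AA -> measurable_fun setT BB ->
    measurable_fun setT psi -> measurable_fun setT phi ->
    is_splitting P F W ups sigma tau AA BB psi phi p0 q0 Pn Qn Pb Qb Pt Qt ->
    forall T : R, 0 < T ->
    (ereal_sup
       [set 'E_P[fun w => expR (Ce * (`|Pn n w| ^+ 2 + `|Qn n w| ^+ 4)
                                / expR (sigma ^+ 2 * grid tau n))]
       | n in [set n : nat | (0 <= grid tau n <= T)%R]]
     <= (expR (C * (T + 1) + hamiltonian ups p0 q0))%:E)%E.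
Proof.
have [Ce0 [C' C'0 CH]] := Ce_adm.
have D0 : 0 <= growth_rate ups sigma.
  rewrite /growth_rate addr_ge0 ?divr_ge0 ?mulr_ge0 ?addr_ge0 ?sqr_ge0
    ?exprn_ge0//; exact: ltW.
(* C' shifts H so that it dominates the weighted powers of P and Q *)
exists (growth_rate ups sigma + C'); first by rewrite ltr_wpDl.
move=> d Om P F W tau AA BB psi phi p0 q0 Pn Qn Pb Qb Pt Qt _ filF wienW
  /andP[tau0 _] _ _ mpsi mphi split T T0.
apply: ge_ereal_sup => _ [n /= /andP[tn0 tnT] <-].
have [FP FQ] := splitting_adapted filF tau0 split n.
have mP := adapted_at_measurable filF tn0 FP.
have mQ := adapted_at_measurable filF tn0 FQ.
set t := grid tau n in tn0 tnT FP FQ *.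
have mE := measurable_energy ups sigma t mP mQ.
apply: (@le_trans _ _ ((expR C')%:E * energy_moment P ups sigma t (Pn n) (Qn n))%E).
  rewrite -ge0_integralZl//.
  rewrite unlock; apply: ge0_le_integral => //.
  - apply/measurable_EFinP; apply: measurableT_comp => //.
    apply: measurable_funM => //; apply: measurable_funM => //.
    by apply: measurable_funD; apply: measurable_funX; exact: measurableT_comp.
  - exact: measurable_funeM.
  - move=> w _; rewrite -EFinM lee_fin -expRD ler_expR.
    rewrite -expRN -/(discount sigma t) -!normrX !ger0_norm ?sqr_ge0 ?exprn_even_ge0//.
    have [Hw _] := CH (Pn n w) (Qn n w).
    have dt0 : 0 <= discount sigma t by exact: expR_ge0.
    have dt1 : discount sigma t <= 1.
      by rewrite -expR0 ler_expR oppr_le0 mulr_ge0 ?sqr_ge0.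
    have := ler_wpM2r dt0 Hw.
    have : C' * discount sigma t <= C' by rewrite ler_piMr// ltW.
    by rewrite mulrDl; lra.
apply: (le_trans (lee_wpmul2l _
  (splitting_energy_moment filF wienW ups_gt0 tau0 mpsi mphi split n))).
  by rewrite lee_fin expR_ge0.
rewrite -EFinM -expRD lee_fin ler_expR addrA lerD2r -/t.
have : growth_rate ups sigma * t <= growth_rate ups sigma * T by rewrite ler_wpM2l.
have : 0 <= C' * T by rewrite mulr_ge0// ltW.
by lra.
Qed.
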